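(* Let $\mathbb{K}$ be a field and let $I\subset\mathbb{K}[x_1,\ldots,x_m]$ and $J\subset\mathbb{K}[y_1,\ldots,y_n]$ be nonzero proper homogeneous ideals. If $I^s=I^{(s)}$ for all $s\ge1$, then $\rho(I+J)=\rho(J)$, where $I+J$ denotes the ideal generated by $I$ and $J$ in $\mathbb{K}[x_1,\ldots,x_m,y_1,\ldots,y_n]$.
   Context: For an ideal $I$ in a Noetherian ring $R$, $I^{(s)}=\bigcap_{P\in\mathrm{Ass}(I)}(I^sR_P\cap R)$ is the $s$-th symbolic power. The resurgence is $\rho(I)=\sup\{s/t : s,t\in\mathbb{N},\ I^{(s)}\not\subset I^t\}$, where $\mathbb{N}$ denotes the positive integers. *)

(* Defs.v *)
From HB Require Import structures.
From mathcomp Require Import all_boot all_order all_algebra.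
(* Must precede the MathComp-Analysis files: in the other order its notations
   clash with theirs. *)
From mathcomp Require Export mpoly.
From mathcomp Require Export boolp classical_sets reals constructive_ereal ereal.

Set Implicit Arguments.
Unset Strict Implicit.
Unset Printing Implicit Defensive.

Import GRing.Theory.
Local Open Scope classical_set_scope.
Local Open Scope ring_scope.

(* Ideals are [set]s; [idealr_closed] of ring_quotient contains properness. *)

Section Ideals.
Variable S : comNzRingType.
Implicit Types (C A I J : set S).

(* The finite sums of elements of A with coefficients in C: the C-submodule
   generated by A when C is a subring. *)
Definition lin_span C A : set S :=
  [set f | exists (k : nat) (c a : 'I_k -> S),
     [/\ forall i, C (c i), forall i, A (a i) & f = \sum_(i < k) c i * a i]].

Definition ideal_gen A : set S := lin_span setT A.

Definition ideal_mul I J : set S :=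
  ideal_gen [set f | exists a b, [/\ I a, J b & f = a * b]].

Definition ideal_pow I (s : nat) : set S := iter s (ideal_mul I) setT.

(* Ass(I) is the set of associated primes of the quotient S/I, that is, of the
   prime ideals of the form (I : f). *)
Definition associated_primes I : set (set S) :=
  [set P | [/\ idealr_closed (mem P), prime_idealr_closed (mem P)
             & exists f, P = [set g | I (g * f)]]].

End Ideals.

Section SymbolicPowers.
Variable D : idomainType.
Implicit Types (I P : set D).

(* As D is a domain, its localization at a prime P is the subring of the
   field of fractions of D consisting of the a / b with b not in P. *)
Definition localization_at P : set {fraction D} :=
  [set z | exists a b : D, ~ P b /\ z = tofrac a / tofrac b].

Definition localized_ideal P I : set {fraction D} :=
  lin_span (localization_at P) (@tofrac D @` I).

Definition symbolic_power I (s : nat) : set D :=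
  \bigcap_(P in associated_primes I)
     (@tofrac D @^-1` localized_ideal P (ideal_pow I s)).

(* The supremum is taken in the extended reals: no finiteness is presupposed. *)
Definition resurgence (R : realType) I : \bar R :=
  ereal_sup [set x | exists s t : nat,
    [/\ (0 < s)%N, (0 < t)%N, ~ (symbolic_power I s `<=` ideal_pow I t)
      & x = (s%:R / t%:R)%:E]].

End SymbolicPowers.

Definition homogeneous_ideal (K : fieldType) (n : nat)
    (I : set {mpoly K[n]}) : Prop :=
  exists2 A : set {mpoly K[n]},
    (forall f, A f -> exists d : nat, f \is d.-homog) & I = ideal_gen A.

(* The variables of {mpoly K[m + n]} are x_1, ..., x_m followed by
   y_1, ..., y_n. *)
Definition x_embed (K : fieldType) (m n : nat) (p : {mpoly K[m]}) :
    {mpoly K[m + n]} :=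
  p \mPo [tuple 'X_(lshift n i) | i < m].

Definition y_embed (K : fieldType) (m n : nat) (p : {mpoly K[n]}) :
    {mpoly K[m + n]} :=
  p \mPo [tuple 'X_(rshift m j) | j < n].

Definition ideal_sum (K : fieldType) (m n : nat)
    (I : set {mpoly K[m]}) (J : set {mpoly K[n]}) : set {mpoly K[m + n]} :=
  ideal_gen ((@x_embed K m n @` I) `|` (@y_embed K m n @` J)).

(* Main.v *)
Require Import Defs.
From HB Require Import structures.
From mathcomp Require Import all_boot all_order all_algebra.
From mathcomp Require Import ssrcomplements boolp classical_sets.

(** Let A and B be the two polynomial rings and S their tensor product over K.
   Two comparisons with ideals of the form I' + J', where I' comes from A and J'
   from B, carry the proof:
   - (I + J)^(s) is contained in I^(a) + J^(b) whenever a + b = s + 1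
     ([saturated_join_sub]);
   - the intersection of the I^a + J^b over a + b = t + 1 with a, b >= 1 is
     contained in (I + J)^t ([bigcap_join_sub_pow]).
   Suppose that I^(a) = I^a for all a >= 1. If s >= t and (I + J)^(s) is not
   contained in (I + J)^t, they give some a < t such that J^(s-a) is not contained
   in J^(t-a), and (s-a)/(t-a) >= s/t. If s < t, then s/t <= s/(s+1), and s/(s+1)
   occurs for J because J^s is not contained in J^(s+1), for reasons of degree
   ([homogeneous_pow_not_sub]). So the resurgence of I + J is at most that of J.

   For the other inequality, a prime associated with I + J contracts to a prime
   associated with J ([contract_associated_prime]), so J^(s) extends into
   (I + J)^(s), while a functional on A that kills I but not 1 shows that
   (I + J)^t contracts to J^t ([pow_join_contract]).

   The second comparison is the distributivity of the lattice generated by two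
   chains in a modular lattice. The first one says that if F is not in
   I^(a) + J^(b), then some prime associated with I + J contains the annihilator
   of F modulo I^(a) + J^(b). By definition of the symbolic power, the annihilator
   of every nonzero element of A / I^(a) lies in a prime associated with I. This
   is used to replace I^(a) by I ([colon_join_transfer]): A / I^(a) has a quotient
   in which, after localization at such a prime P, the residue field of P is an
   essential submodule ([socle_extension]); a multiple of F has all its
   coordinates there, and A / P embeds in A / I. Once J^(b) has likewise been
   replaced by J, it remains to put the annihilator of an element modulo I + J
   into an associated prime, which is possible because S is Noetherian
   ([noetherian_mpoly], proved with leading monomials and Dickson's lemma).

   Coordinates of elements of S are taken with respect to finite families of B
   that are linearly independent modulo an ideal ([tens_coordinates]). *)

Set Implicit Arguments.
Unset Strict Implicit.
Unset Printing Implicit Defensive.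

Import Order.TTheory GRing.Theory Num.Theory.
Local Open Scope classical_set_scope.
Local Open Scope ring_scope.

(** * Ideals, their powers and their associated primes *)

Section Ideals.
Variable S : comNzRingType.
Implicit Types (I J P X : set S).

Definition is_ideal I : Prop :=
  [/\ I 0, forall x y, I x -> I y -> I (x + y) & forall c x, I x -> I (c * x)].

Definition colon I (f : S) : set S := [set c | I (c * f)].

Lemma is_idealN I x : is_ideal I -> I x -> I (- x).
Proof. by case=> _ _ IM Ix; rewrite -mulN1r; exact: IM. Qed.

Lemma is_idealB I x y : is_ideal I -> I x -> I y -> I (x - y).
Proof. by move=> idI Ix Iy; case: (idI) => _ ID _; apply: ID => //; exact: is_idealN. Qed.

Lemma is_ideal_sum I (r : nat) (F : 'I_r -> S) :
  is_ideal I -> (forall k, I (F k)) -> I (\sum_(k < r) F k).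
Proof. by case=> I0 ID _ IF; apply: big_ind => //. Qed.

Lemma is_idealT : is_ideal [set: S].
Proof. by []. Qed.

Lemma idealr_closedP I : idealr_closed (mem I) <-> is_ideal I /\ ~ I 1.
Proof.
rewrite /idealr_closed; split.
  case; rewrite inE => I0 /negP; rewrite inE => I1 IL; split=> //; split=> //.
    move=> x y Ix Iy; have := IL 1 x y.
    by rewrite mul1r !inE; apply.
  move=> c x Ix; have := IL c x 0.
  by rewrite addr0 !inE; apply.
case=> -[I0 ID IM] I1; split; first by rewrite inE.
  by apply/negP; rewrite inE.
by move=> c x y; rewrite !inE => Ix Iy; apply: ID => //; apply: IM.
Qed.

Lemma prime_idealr_closedP P :
  prime_idealr_closed (mem P) <-> forall u v, P (u * v) -> P u \/ P v.
Proof.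
split=> prP u v.
  by move=> Puv; have := prP u v; rewrite !inE => /(_ Puv) /orP[]; rewrite inE;
     [left | right].
by rewrite !inE => /prP[] H; apply/orP; rewrite !inE; [left | right].
Qed.

Lemma is_ideal_colon I f : is_ideal I -> is_ideal (colon I f).
Proof.
case=> I0 ID IM; split=> [|x y Ix Iy|c x Ix]; rewrite /colon /mkset.
- by rewrite mul0r.
- by rewrite mulrDl; apply: ID.
by rewrite -mulrA; apply: IM.
Qed.

Lemma is_ideal_gen X : is_ideal (ideal_gen X).
Proof.
split.
- by exists 0%N, (fun=> 0), (fun=> 0); split=> [[]//|[]//|]; rewrite big_ord0.
- move=> _ _ [k [c [a [_ aX ->]]]] [k' [c' [a' [_ aX' ->]]]].
  exists (k + k')%N,
    (fun i => match split i with inl l => c l | inr l => c' l end),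
    (fun i => match split i with inl l => a l | inr l => a' l end).
  split=> // [i|]; first by case: (split i).
  rewrite big_split_ord /=; congr (_ + _); apply: eq_bigr => l _.
    by rewrite -[lshift _ _]/(unsplit (inl l)) unsplitK.
  by rewrite -[rshift _ _]/(unsplit (inr l)) unsplitK.
move=> d _ [k [c [a [_ aX ->]]]]; exists k, (fun i => d * c i), a; split=> //.
by rewrite mulr_sumr; apply: eq_bigr => i _; rewrite mulrA.
Qed.

Lemma ideal_gen_sub X : X `<=` ideal_gen X.
Proof.
move=> x Xx; exists 1%N, (fun=> 1), (fun=> x); split=> //.
by rewrite big_ord1 mul1r.
Qed.

Lemma ideal_gen_min X I : is_ideal I -> X `<=` I -> ideal_gen X `<=` I.
Proof.
move=> idI XI _ [k [c [a [_ aX ->]]]]; apply: is_ideal_sum => // i.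
by case: idI => _ _; apply; apply: XI.
Qed.

Lemma ideal_mulM I J a b : I a -> J b -> ideal_mul I J (a * b).
Proof. by move=> Ia Jb; apply: ideal_gen_sub; exists a, b. Qed.

Lemma ideal_mul_min I J X :
  is_ideal X -> (forall a b, I a -> J b -> X (a * b)) -> ideal_mul I J `<=` X.
Proof. by move=> idX sX; apply: ideal_gen_min => // _ [a [b [? ? ->]]]; exact: sX. Qed.

Lemma is_ideal_pow I s : is_ideal (ideal_pow I s).
Proof. by case: s => // s; apply: is_ideal_gen. Qed.

Lemma ideal_powS I s a b : I a -> ideal_pow I s b -> ideal_pow I s.+1 (a * b).
Proof. exact: ideal_mulM. Qed.

Lemma ideal_powS_min I s X : is_ideal X ->
  (forall a b, I a -> ideal_pow I s b -> X (a * b)) -> ideal_pow I s.+1 `<=` X.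
Proof. exact: ideal_mul_min. Qed.

Lemma ideal_powSn_sub I s : ideal_pow I s.+1 `<=` ideal_pow I s.
Proof.
apply: ideal_powS_min => [|a b _ Ib]; first exact: is_ideal_pow.
by case: (is_ideal_pow I s) => _ _; apply.
Qed.

Lemma ideal_pow_sub I s t : (s <= t)%N -> ideal_pow I t `<=` ideal_pow I s.
Proof.
move=> /subnK <-; elim: (t - s)%N => // k IHk.
by rewrite addSn; apply: subset_trans IHk; exact: ideal_powSn_sub.
Qed.

Lemma ideal_powD I s t a b :
  ideal_pow I s a -> ideal_pow I t b -> ideal_pow I (s + t)%N (a * b).
Proof.
elim: s a => [|s IHs] a Ia Ib.
  by rewrite add0n; case: (is_ideal_pow I t) => _ _; apply.
have idX := is_ideal_colon b (is_ideal_pow I (s.+1 + t)%N).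
apply: (ideal_powS_min idX) Ia => x y Ix Iy.
by rewrite /colon /mkset -mulrA addSn; apply: ideal_powS => //; apply: IHs.
Qed.

Lemma ideal_pow_exp I s a : I a -> ideal_pow I s (a ^+ s).
Proof. by move=> Ia; elim: s => // s IHs; rewrite exprS; apply: ideal_powS. Qed.

Lemma associated_primesP I P : associated_primes I P ->
  [/\ is_ideal P, ~ P 1, forall u v, P (u * v) -> P u \/ P v
    & exists f, P = colon I f].
Proof. by case=> /idealr_closedP[? ?] /prime_idealr_closedP ? ?; split. Qed.

(** If [u * v] multiplies [f] into [I] and [v] does not, then [u] multiplies
   [v * f] into [I], hence also [f] by maximality. *)
Lemma maximal_colon_prime I f : is_ideal I -> ~ I f ->
  (forall v, ~ I (v * f) -> colon I (v * f) `<=` colon I f) ->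
  associated_primes I (colon I f).
Proof.
move=> idI nIf fmax; split.
- apply/idealr_closedP; split; last by rewrite /colon /= mul1r.
  exact: is_ideal_colon.
- apply/prime_idealr_closedP => u v Iuv.
  have [Iv|nIv] := pselect (I (v * f)); first by right.
  by left; apply: (fmax v nIv); rewrite /colon /= mulrA.
by exists f.
Qed.

(** The symbolic power with its denominators cleared, which makes sense over any
   commutative ring. *)
Definition saturated_power I (s : nat) : set S :=
  [set F | forall P, associated_primes I P ->
     exists2 h, ~ P h & ideal_pow I s (h * F)].

Lemma ideal_pow_sub_saturated I s : ideal_pow I s `<=` saturated_power I s.
Proof.
by move=> F IF P /associated_primesP[_ nP1 _ _]; exists 1; rewrite ?mul1r.
Qed.

Lemma is_ideal_saturated I s : is_ideal (saturated_power I s).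
Proof.
have [I0 ID IM] := is_ideal_pow I s; split.
- exact: ideal_pow_sub_saturated.
- move=> x y Ix Iy P PI; have [idP nP1 prP _] := associated_primesP PI.
  have [h nPh Ih] := Ix P PI; have [h' nPh' Ih'] := Iy P PI.
  exists (h * h'); first by move=> /prP[].
  rewrite mulrDr; apply: ID; last by rewrite -mulrA; apply: IM.
  by rewrite mulrAC mulrC; apply: IM.
move=> c x Ix P PI; have [h nPh Ih] := Ix P PI; exists h => //.
by rewrite mulrCA; apply: IM.
Qed.

(** If no element outside [P] multiplies [F] into [ideal_pow I s], then every [c]
   that multiplies [F] into the saturation is in [P]: otherwise [h * c], where
   [h] is outside [P] and [h * (c * F)] is in the power, would be such an
   element. *)
Lemma saturated_colon_sub I s F : ~ saturated_power I s F ->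
  exists2 P, associated_primes I P & colon (saturated_power I s) F `<=` P.
Proof.
move=> nF; apply: contrapT => nP; apply: nF => P PI.
have [idP nP1 prP _] := associated_primesP PI.
apply: contrapT => nh; apply: nP; exists P => // c /(_ P PI)[h nPh Ih].
apply: contrapT => nPc; apply: nh.
by exists (h * c); [move=> /prP[] | rewrite -mulrA].
Qed.

End Ideals.

Section Symbolic.
Variable D : idomainType.
Implicit Types (I P : set D).

Lemma tofrac_nz (P : set D) b : is_ideal P -> ~ P b -> tofrac b != 0.
Proof.
case=> P0 _ _ nPb; rewrite tofrac_eq0; apply/eqP => b0; apply: nPb.
by rewrite b0.
Qed.

(** In a combination of fractions that represents [F], the denominators are
   cleared one summand at a time; they remain outside [P] since [P] is prime. *)
Lemma symbolic_powerE I s : symbolic_power I s = saturated_power I s.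
Proof.
have [I0 ID IM] := is_ideal_pow I s.
apply/seteqP; split=> F H P PI; have [idP nP1 prP _] := associated_primesP PI.
  have [k [c [a [cP aI]]]] := H P PI.
  elim: k F c a cP aI {H} => [|k IHk] F c a cP aI.
    rewrite big_ord0 => /eqP; rewrite tofrac_eq0 => /eqP ->.
    by exists 1; rewrite ?mulr0.
  rewrite big_ord_recl.
  have [u [v [nPv cE]]] := cP ord0; have [g Ig gE] := aI ord0.
  have nzv := tofrac_nz idP nPv.
  rewrite cE -gE => FE.
  have [|||h nPh Ih] := IHk (v * F - u * g) (fun i => tofrac v * c (lift ord0 i))
      (fun i => a (lift ord0 i)).
  - move=> i; have [u' [v' [nPv' ->]]] := cP (lift ord0 i).
    by exists (v * u'), v'; split=> //; rewrite tofracM mulrA.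
  - by move=> i; apply: aI.
  - rewrite tofracB !tofracM FE mulrDr mulr_sumr.
    rewrite [X in X + _ - _]mulrA [X in X * _ + _ - _]mulrCA divff // mulr1.
    rewrite addrAC subrr add0r.
    by apply: eq_bigr => i _; rewrite mulrA.
  exists (h * v); first by move=> /prP[].
  have -> : h * v * F = h * (v * F - u * g) + (h * u) * g.
    by rewrite mulrBr !mulrA subrK.
  by apply: ID => //; apply: IM.
have [h nPh Ih] := H P PI.
have nzh := tofrac_nz idP nPh.
exists 1%N, (fun=> (tofrac h)^-1), (fun=> tofrac (h * F)); split=> [_|_|].
- by exists 1, h; rewrite tofrac1 mul1r.
- by exists (h * F).
by rewrite big_ord1 tofracM mulrA mulVf // mul1r.
Qed.

End Symbolic.

(** * Maximal subspaces and maximal ideals *)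

Lemma Zorn_above (T : Type) (P : set (set T)) (V : set T) : P V ->
  (forall C : set (set T), C `<=` P -> C !=set0 -> total_on C subset ->
     P (\bigcup_(U in C) U)) ->
  exists M, [/\ P M, V `<=` M & forall N, P N -> M `<=` N -> N `<=` M].
Proof.
move=> PV chainP.
(* The empty set is allowed because [Zorn_bigcup] also tests empty chains. *)
pose Q : set (set T) := [set U | U = set0 \/ P U /\ V `<=` U].
have chainQ C : C `<=` Q -> total_on C subset -> Q (\bigcup_(U in C) U).
  move=> CQ totC; pose C' := [set U | C U /\ U <> set0].
  have CC' : \bigcup_(U in C) U = \bigcup_(U in C') U.
    apply/seteqP; split=> x [U CU Ux]; last by exists U => //; case: CU.
    by exists U => //; split=> // U0; rewrite U0 in Ux.
  have [C0|/eqP/set0P[U0 C'U0]] := pselect (C' = set0); last first.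
    right; rewrite CC'; have C'Q U : C' U -> P U /\ V `<=` U.
      by case=> CU U0'; case: (CQ _ CU).
    split; last by move=> x Vx; exists U0 => //; apply: (C'Q _ C'U0).2.
    apply: chainP; last 1 first.
    - by move=> U W [CU _] [CW _]; apply: totC.
    - by move=> U /C'Q[].
    by exists U0.
  by left; rewrite CC' C0 bigcup_set0.
have [M [[M0|[PM VM]] maxM]] := Zorn_bigcup chainQ.
  have V0 : V = set0.
    apply: contrapT => VN0; apply: (maxM V); last by right; split.
    by rewrite M0; split=> // V0; apply: VN0; apply/seteqP; split.
  exists V; split=> // N PN VN; apply: contrapT => NV.
  apply: (maxM N); last by right; split.
  by rewrite M0; split=> // N0; apply: NV; apply: subset_trans N0 _.
exists M; split=> // N PN MN; apply: contrapT => NM; apply: (maxM N) => //.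
by right; split=> //; apply: subset_trans MN.
Qed.

Section Functionals.
Variables (K : fieldType) (B : lmodType K).
Implicit Types (U V : set B).

Definition is_subspace U : Prop :=
  U 0 /\ forall c u v, U u -> U v -> U (c *: u + v).

Lemma is_subspaceZ U c u : is_subspace U -> U u -> U (c *: u).
Proof. by case=> U0 UL Uu; rewrite -[_ *: _]addr0; apply: UL. Qed.

Lemma is_subspaceB U u v : is_subspace U -> U u -> U v -> U (u - v).
Proof. by case=> U0 UL Uu Uv; rewrite addrC -scaleN1r; apply: UL. Qed.

(** A maximal subspace that contains [V] but not [b] is a hyperplane, hence the
   kernel of a functional. *)
Lemma separating_functional V b : is_subspace V -> ~ V b ->
  exists phi : {scalar B}, (forall v, V v -> phi v = 0) /\ phi b = 1.
Proof.
move=> sV nVb.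
have [||M [[sM nMb] VM maxM]] :=
    @Zorn_above B [set U | is_subspace U /\ ~ U b] V.
- by [].
- move=> C CP [U0 CU0] totC; split; last by move=> [U /CP[_ nUb]].
  split; first by exists U0 => //; case: (CP _ CU0) => -[].
  move=> c u v [U CU Uu] [W CW Wv].
  have [UW|WU] := totC _ _ CU CW.
    by exists W => //; have [[_ WL] _] := CP _ CW; apply: WL => //; apply: UW.
  by exists U => //; have [[_ UL] _] := CP _ CU; apply: UL => //; apply: WU.
have [M0 ML] := sM.
have decomp x : exists c : K, M (x - c *: b).
  have [Mx|nMx] := pselect (M x); first by exists 0; rewrite scale0r subr0.
  pose N := [set y | exists d : K, M (y - d *: x)].
  have [d Md] : N b.
    apply: contrapT => nNb; apply: nMx.
    have : N x by exists 1; rewrite scale1r subrr.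
    apply: maxM; last by move=> y My; exists 0; rewrite scale0r subr0.
    split=> //; split; first by exists 0; rewrite scale0r subrr.
    move=> c u v [d Md] [d' Md']; exists (c * d + d').
    have -> : c *: u + v - (c * d + d') *: x
              = c *: (u - d *: x) + (v - d' *: x).
      by rewrite scalerDl scalerBr scalerA opprD addrACA.
    exact: ML.
  have [d0|nd0] := eqVneq d 0; first by case: nMb; rewrite d0 scale0r subr0 in Md.
  exists d^-1; have := is_subspaceZ (- d^-1) sM Md.
  by rewrite scalerBr !scaleNr opprK scalerA mulVf // scale1r addrC.
have [phi phiM] := choice decomp.
have uniq_coef x c : M (x - c *: b) -> c = phi x.
  move=> Mx; apply/eqP/negPn/negP => neq; apply: nMb.
  have nz : phi x - c != 0 by rewrite subr_eq0 eq_sym.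
  have := is_subspaceB sM Mx (phiM x).
  rewrite opprB addrC addrA subrK -scalerBl.
  move=> /(is_subspaceZ (phi x - c)^-1 sM).
  by rewrite scalerA mulVf // scale1r.
have phi_lin : linear_for *%R phi.
  move=> c u v; apply/esym/uniq_coef.
  have -> : c *: u + v - (c * phi u + phi v) *: b
            = c *: (u - phi u *: b) + (v - phi v *: b).
    by rewrite scalerDl scalerBr scalerA opprD addrACA.
  exact: ML.
pose phiL : {scalar B} := HB.pack phi (GRing.isLinear.Build K B K *%R phi phi_lin).
exists phiL; split=> [v /VM Mv|].
  by apply/esym/(uniq_coef v); rewrite scale0r subr0.
by apply/esym/(uniq_coef b); rewrite scale1r subrr.
Qed.

End Functionals.

Section SocleExtension.
Variable A : comNzRingType.
Implicit Types (L P : set A).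

(** [N] is taken maximal among the ideals containing [L] with
   [colon N a `<=` P]. After localization at [P], the class of [a] then generates
   an essential submodule of the quotient by [N], isomorphic to the residue field
   of [P]. *)
Lemma socle_extension L P a : is_ideal L -> is_ideal P -> ~ P 1 ->
  (forall u v, P (u * v) -> P u \/ P v) -> colon L a `<=` P ->
  exists N, [/\ is_ideal N, L `<=` N, colon N a = P
    & forall z, ~ N z -> exists e c, ~ P e /\ N (e * a - c * z)].
Proof.
move=> idL idP nP1 prP LaP.
have [||M [[idM MaP] LM maxM]] :=
    @Zorn_above A [set U | is_ideal U /\ colon U a `<=` P] L.
- by [].
- move=> C CP [U0 CU0] totC; split; last by move=> c [U /CP[_ UaP]]; apply: UaP.
  split; first by exists U0 => //; case: (CP _ CU0) => -[].
    move=> u v [U CU Uu] [W CW Wv].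
    have [UW|WU] := totC _ _ CU CW.
      by exists W => //; have [[_ WD _] _] := CP _ CW; apply: WD => //; apply: UW.
    by exists U => //; have [[_ UD _] _] := CP _ CU; apply: UD => //; apply: WU.
  by move=> c u [U CU Uu]; exists U => //; have [[_ _ UM] _] := CP _ CU; apply: UM.
have [M0 MD MM] := idM; have [P0 PD PM] := idP.
have ess z : ~ M z -> exists e c, ~ P e /\ M (e * a - c * z).
  move=> nMz; apply: contrapT => H; apply: nMz.
  pose N := [set y | exists c, M (y - c * z)].
  have : N z by exists 1; rewrite mul1r subrr.
  apply: maxM; last by move=> y My; exists 0; rewrite mul0r subr0.
  split; last first.
    by move=> e [c Mc]; apply: contrapT => nPe; apply: H; exists e, c.
  split; first by exists 0; rewrite mul0r subrr.
    move=> u v [c Mc] [d Md]; exists (c + d).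
    by rewrite mulrDl opprD addrACA; apply: MD.
  by move=> d u [c Mc]; exists (d * c); rewrite -mulrA -mulrBr; apply: MM.
exists M; split=> //; apply/seteqP; split=> // p Pp.
apply: contrapT => nMpa; have [e [c [nPe]]] := ess _ nMpa.
rewrite mulrA -mulrBl => /MaP Pecp; apply: nPe.
by rewrite -[e](subrK (c * p)); apply: PD => //; apply: PM.
Qed.

(** The entries are brought into the submodule generated by [a] one after the
   other. The multiplier that treats one entry may kill the previous ones, but
   that entry stays nonzero. *)
Lemma socle_multiplier N a r (x : nat -> A) : is_ideal N ->
  (forall z, ~ N z -> exists e c, ~ N (e * a) /\ N (e * a - c * z)) ->
  (exists2 k, (k < r)%N & ~ N (x k)) ->
  exists c, (exists2 k, (k < r)%N & ~ N (c * x k)) /\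
    forall k, (k < r)%N -> exists d, N (c * x k - d * a).
Proof.
move=> idN ess nNx; have [N0 ND NM] := idN.
suff H s : (s <= r)%N -> exists c, (exists2 k, (k < r)%N & ~ N (c * x k)) /\
    forall k, (k < s)%N -> exists d, N (c * x k - d * a) by exact: H.
elim: s => [|s IHs] sr.
  by exists 1; split=> //; have [k kr nNk] := nNx; exists k; rewrite ?mul1r.
have [c [nNc cN]] := IHs (ltnW sr).
have [Ns|nNs] := pselect (N (c * x s)).
  exists c; split=> // k; rewrite ltnS leq_eqVlt => /orP[/eqP ->|]; last exact: cN.
  by exists 0; rewrite mul0r subr0.
have [e [d [nNe Ned]]] := ess _ nNs.
exists (d * c); split.
  exists s => // Ns; apply: nNe; rewrite -[e * a](subrK (d * (c * x s))).
  by apply: ND => //; rewrite mulrA.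
move=> k; rewrite ltnS leq_eqVlt => /orP[/eqP ->|/cN[d' Nd']].
  by exists e; rewrite -mulrA -opprB; apply: is_idealN.
by exists (d * d'); rewrite -!mulrA -mulrBr; apply: NM.
Qed.

End SocleExtension.

(** * Tensor products of algebras over a field *)

(** The image of the tensor product of [X] and [Y]; an inductive predicate gives
   induction on the number of summands. *)
Inductive tens (A B S : comNzRingType) (i : A -> S) (j : B -> S)
    (X : set A) (Y : set B) : S -> Prop :=
| tens0 : tens i j X Y 0
| tens_cons a b F : X a -> Y b -> tens i j X Y F ->
    tens i j X Y (i a * j b + F).

(** [S] is the tensor product of [A] and [B] over [K]. Instead of the universal
   property, functionals on either factor act on [S]: this gives coordinates
   without a choice of bases. *)
Record is_tensor (K : fieldType) (A B S : comAlgType K)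
    (i : {lrmorphism A -> S}) (j : {lrmorphism B -> S}) : Prop := IsTensor {
  tensor_gen : forall F, tens i j setT setT F;
  tensor_ext_r : forall phi : {scalar B}, exists Phi : {additive S -> A},
    forall a b, Phi (i a * j b) = phi b *: a;
  tensor_ext_l : forall phi : {scalar A}, exists Phi : {additive S -> B},
    forall a b, Phi (i a * j b) = phi a *: b
}.

Section TensBasics.
Variables (A B S : comNzRingType) (i : A -> S) (j : B -> S).
Implicit Types (X : set A) (Y : set B).

Lemma tens_pure X Y a b : X a -> Y b -> tens i j X Y (i a * j b).
Proof. by move=> Xa Yb; rewrite -[_ * _]addr0; apply: tens_cons => //; apply: tens0. Qed.

Lemma tensD X Y F G : tens i j X Y F -> tens i j X Y G -> tens i j X Y (F + G).
Proof.
move=> + XYG; elim=> [|a b F' Xa Yb _ IH]; first by rewrite add0r.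
by rewrite -addrA; apply: tens_cons.
Qed.

Lemma tensS X X' Y Y' F : X `<=` X' -> Y `<=` Y' ->
  tens i j X Y F -> tens i j X' Y' F.
Proof.
move=> XX' YY'; elim=> [|a b F' Xa Yb _ IH]; first exact: tens0.
by apply: tens_cons; [apply: XX' | apply: YY' |].
Qed.

Lemma tens_sum X Y r (F : 'I_r -> S) : (forall k, tens i j X Y (F k)) ->
  tens i j X Y (\sum_(k < r) F k).
Proof. by move=> XYF; apply: big_ind => //; [apply: tens0 | apply: tensD]. Qed.

Lemma tens_sub X Y (Z : set S) : is_ideal Z ->
  (forall a b, X a -> Y b -> Z (i a * j b)) -> tens i j X Y `<=` Z.
Proof.
move=> [Z0 ZD _] XYZ F; elim=> // a b F' Xa Yb _ ZF'.
by apply: ZD => //; apply: XYZ.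
Qed.

End TensBasics.

Lemma tensC (A B S : comNzRingType) (i : A -> S) (j : B -> S) X Y F :
  tens i j X Y F -> tens j i Y X F.
Proof.
by elim=> [|a b F' Xa Yb _ IH]; [apply: tens0 | rewrite mulrC; apply: tens_cons].
Qed.

Section Tensor.
Variables (K : fieldType) (A B S : comAlgType K).
Variables (i : {lrmorphism A -> S}) (j : {lrmorphism B -> S}).
Hypothesis tens_ij : is_tensor i j.
Implicit Types (X I L P : set A) (Y J M : set B) (F G H : S).

Lemma is_idealZ (R : comAlgType K) (U : set R) (c : K) u :
  is_ideal U -> U u -> U (c *: u).
Proof. by case=> _ _ UM Uu; rewrite -[u]mul1r scalerAl; apply: UM. Qed.

Lemma is_ideal_tens X Y : is_ideal X -> is_ideal Y -> is_ideal (tens i j X Y).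
Proof.
move=> [X0 XD XM] [Y0 YD YM]; split; [exact: tens0 | by move=> *; apply: tensD |].
move=> F G; elim: (tensor_gen tens_ij F) => [|a b F' _ _ _ IH] XYG.
  by rewrite mul0r; apply: tens0.
rewrite mulrDl; apply: tensD; last exact: IH.
elim: XYG => [|c d G' Xc Yd _ IHG]; first by rewrite mulr0; apply: tens0.
rewrite mulrDr; apply: tensD => //.
by rewrite mulrACA -!rmorphM; apply: tens_pure; [apply: XM | apply: YM].
Qed.

(** The sum of the ideals of [S] generated by [X] and by [Y]. *)
Definition join X Y : set S :=
  [set F | exists2 G, tens i j X setT G & tens i j setT Y (F - G)].

Lemma is_ideal_join X Y : is_ideal X -> is_ideal Y -> is_ideal (join X Y).
Proof.
move=> idX idY.
have [X0 XD XM] := is_ideal_tens idX (is_idealT B).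
have [Y0 YD YM] := is_ideal_tens (is_idealT A) idY.
split; first by exists 0 => //; rewrite subrr.
  move=> F F' [G XG YG] [G' XG' YG']; exists (G + G'); first exact: XD.
  by rewrite opprD addrACA; apply: YD.
by move=> F F' [G XG YG]; exists (F * G); [apply: XM | rewrite -mulrBr; apply: YM].
Qed.

Lemma join_inl X Y a : X a -> join X Y (i a).
Proof.
move=> Xa; exists (i a); last by rewrite subrr; apply: tens0.
by rewrite -[i a]mulr1 -[1](rmorph1 j); apply: tens_pure.
Qed.

Lemma join_inr X Y b : Y b -> join X Y (j b).
Proof.
move=> Yb; exists 0; first exact: tens0.
by rewrite subr0 -[j b]mul1r -[1](rmorph1 i); apply: tens_pure.
Qed.

Lemma join_sub_tens_l X Y : tens i j X setT `<=` join X Y.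
Proof. by move=> F XF; exists F => //; rewrite subrr; apply: tens0. Qed.

Lemma join_sub_tens_r X Y : tens i j setT Y `<=` join X Y.
Proof. by move=> F YF; exists 0; [apply: tens0 | rewrite subr0]. Qed.

Lemma joinS X X' Y Y' : X `<=` X' -> Y `<=` Y' -> join X Y `<=` join X' Y'.
Proof.
by move=> XX' YY' F [G XG YG]; exists G; [move: XG | move: YG]; apply: tensS.
Qed.

Lemma join_min X Y (Z : set S) : is_ideal Z ->
  (forall a, X a -> Z (i a)) -> (forall b, Y b -> Z (j b)) -> join X Y `<=` Z.
Proof.
move=> idZ XZ YZ F [G XG YG]; have [_ ZD ZM] := idZ.
rewrite -(subrK G F); apply: ZD.
  by apply: tens_sub YG => // a b _ /YZ; apply: ZM.
by apply: tens_sub XG => // a b /XZ Za _; rewrite mulrC; apply: ZM.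
Qed.

(** Every element of the extension of [X] is, up to [tens X Y], a combination of
   elements of [B] that are linearly independent modulo [Y]; a dual family of
   functionals that vanish on [Y] witnesses the independence. *)
Lemma tens_independent X Y F : is_ideal X -> is_ideal Y -> tens i j X setT F ->
  exists r (a : nat -> A) (b : nat -> B) (phi : nat -> {scalar B}),
    [/\ forall k, X (a k),
        tens i j X Y (F - \sum_(k < r) i (a k) * j (b k)),
        forall k y, Y y -> phi k y = 0
      & forall k l, (k < r)%N -> (l < r)%N -> phi k (b l) = (k == l)%:R].
Proof.
move=> idX idY; have [X0 XD _] := idX; have [Y0 YD _] := idY.
elim=> [|a0 b0 F' Xa0 _ _ [r [a [b [phi [aX FY phiY phib]]]]]].
  exists 0%N, (fun=> 0), (fun=> 0), (fun=> [the {scalar B} of \0]).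
  by split=> //; rewrite big_ord0 subr0; apply: tens0.
pose V := [set y | exists c : nat -> K, Y (y - \sum_(k < r) c k *: b k)].
have sV : is_subspace V.
  split; first by exists (fun=> 0); rewrite big1 ?subr0 // => k _; rewrite scale0r.
  move=> d u v [c cu] [c' cv]; exists (fun k => d * c k + c' k).
  have -> : d *: u + v - \sum_(k < r) (d * c k + c' k) *: b k
     = d *: (u - \sum_(k < r) c k *: b k) + (v - \sum_(k < r) c' k *: b k).
    rewrite scalerBr addrACA -opprD scaler_sumr -big_split /=; congr (_ - _).
    by apply: eq_bigr => k _; rewrite scalerDl scalerA.
  by apply: YD => //; apply: is_idealZ.
have [[c cY]|nV] := pselect (V b0).
  (* [b0] depends on the previous elements: its coordinates are absorbed. *)
  exists r, (fun k => a k + c k *: a0), b, phi; split=> // [k|].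
    by apply: XD => //; apply: is_idealZ.
  have -> : i a0 * j b0 + F' - \sum_(k < r) i (a k + c k *: a0) * j (b k)
    = i a0 * j (b0 - \sum_(k < r) c k *: b k)
      + (F' - \sum_(k < r) i (a k) * j (b k)).
    rewrite linearB /= mulrBr addrACA -opprD (linear_sum j) mulr_sumr -big_split /=.
    congr (_ - _); apply: eq_bigr => k _.
    by rewrite linearD /= mulrDl addrC !linearZ /= -scalerAr -scalerAl.
  exact: tens_cons.
(* Otherwise a functional separates [b0] from them and from [Y]. *)
have [psi [psiV psib]] := separating_functional sV nV.
have psi_b k : (k < r)%N -> psi (b k) = 0.
  move=> kr; apply: psiV; exists (fun l => (l == k)%:R).
  rewrite (bigD1 (Ordinal kr)) //= eqxx scale1r big1 ?addr0 ?subrr // => l.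
  by rewrite -val_eqE /= => /negPf ->; rewrite scale0r.
have psiY y : Y y -> psi y = 0.
  move=> Yy; apply: psiV; exists (fun=> 0).
  by rewrite big1 ?subr0 // => k _; rewrite scale0r.
pose chi k y := phi k y - phi k b0 * psi y.
have chi_lin k : linear_for *%R (chi k).
  move=> c u v; rewrite /chi !linearP /= mulrDr mulrBr opprD addrACA.
  by rewrite [phi k b0 * (c * _)]mulrCA.
pose chiL k : {scalar B} :=
  HB.pack (chi k) (GRing.isLinear.Build K B K *%R (chi k) (chi_lin k)).
exists r.+1, (fun k => if k == r then a0 else a k),
  (fun k => if k == r then b0 else b k), (fun k => if k == r then psi else chiL k).
split=> [k||k y Yy|k l].
- by case: eqP.
- rewrite big_ord_recr /= eqxx.
  under eq_bigr => k _ do rewrite ltn_eqF //.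
  by rewrite [_ + F']addrC [X in _ - X]addrC addrKA.
- by case: eqP => _; [exact: psiY | rewrite /= /chi phiY // psiY // mulr0 subrr].
have ltr x : (x < r.+1)%N -> x != r -> (x < r)%N.
  by rewrite ltnS ltn_neqAle => -> ->.
have [->|nkr] := eqVneq k r; have [->|nlr] := eqVneq l r => //= kr lr.
- by rewrite psi_b ?ltr // eq_sym (negPf nlr).
- by rewrite /chi psib mulr1 subrr (negPf nkr).
by rewrite /chi psi_b ?ltr // mulr0 subr0 phib ?ltr.
Qed.

(** The functionals of [tens_independent], applied to the second factor, read off
   the coordinates; since they vanish on [Y], they also test membership in
   [join L Y]. *)
Lemma tens_coordinates X Y F : is_ideal X -> is_ideal Y -> tens i j X setT F ->
  exists r (a : nat -> A) (b : nat -> B) (Phi : nat -> {additive S -> A}),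
    [/\ forall k, X (a k),
        tens i j X Y (F - \sum_(k < r) i (a k) * j (b k)),
        forall k L G, is_ideal L -> join L Y G -> L (Phi k G),
        forall k c G, Phi k (i c * G) = c * Phi k G
      & forall k (c : nat -> A), (k < r)%N -> Phi k (\sum_(l < r) i (c l) * j (b l)) = c k].
Proof.
move=> idX idY XF.
have [r [a [b [phi [aX FY phiY phib]]]]] := tens_independent idX idY XF.
have [Phi PhiE] := choice (fun k => tensor_ext_r tens_ij (phi k)).
exists r, a, b, Phi; split=> // [k L G idL [G1 LG1 YG2]|k c G|k c kr].
- have [L0 LD _] := idL; rewrite -(subrK G1 G) raddfD.
  have -> : Phi k (G - G1) = 0.
    elim: YG2 => [|a' b' G' _ Yb' _ IH]; first exact: raddf0.
    by rewrite raddfD /= IH PhiE phiY // scale0r addr0.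
  rewrite add0r; elim: LG1 => [|a' b' G' La' _ _ IH]; first by rewrite raddf0.
  rewrite raddfD /= PhiE; apply: LD => //.
  exact: is_idealZ.
- elim: (tensor_gen tens_ij G) => [|a' b' G' _ _ _ IH].
    by rewrite mulr0 !raddf0 mulr0.
  by rewrite mulrDr !raddfD /= mulrA -rmorphM !PhiE IH mulrDr scalerAr.
rewrite raddf_sum (bigD1 (Ordinal kr)) //= PhiE phib // eqxx scale1r.
rewrite big1 ?addr0 // => l; rewrite -val_eqE /= => lk.
by rewrite PhiE phib // eq_sym (negPf lk) scale0r.
Qed.

Lemma is_ideal0 (R : comNzRingType) : is_ideal [set 0 : R].
Proof. by split=> [//|x y -> ->|c x ->]; rewrite /= ?addr0 ?mulr0. Qed.

(** An element of the extension of [X] has coordinates in [X], up to [tens X Y];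
   if it is in the extension of [Y], these coordinates vanish. *)
Lemma tens_inter X Y F : is_ideal X -> is_ideal Y ->
  tens i j X setT F -> tens i j setT Y F -> tens i j X Y F.
Proof.
move=> idX idY XF YF.
have [r [a [b [Phi [aX FXY PhiL _ PhiS]]]]] := tens_coordinates idX idY XF.
have a0 k : (k < r)%N -> a k = 0.
  move=> kr; rewrite -[LHS](PhiS k a kr).
  have /= : [set 0] (Phi k (F - \sum_(l < r) i (a l) * j (b l))).
    apply: PhiL; first exact: is_ideal0.
    by apply: join_sub_tens_r; apply: tensS FXY.
  have /= : [set 0] (Phi k F).
    by apply: PhiL; [exact: is_ideal0 | apply: join_sub_tens_r].
  by rewrite raddfB /= => -> /eqP; rewrite sub0r oppr_eq0 => /eqP.
move: FXY; rewrite big1 ?subr0 // => k _.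
by rewrite a0 // rmorph0 mul0r.
Qed.

(** Modulo [Y], both sides are tested on coordinates. *)
Lemma join_colon_sub L P Y a Z : is_ideal L -> is_ideal P -> is_ideal Y ->
  colon L a `<=` P -> join L Y (i a * Z) -> join P Y Z.
Proof.
move=> idL idP idY LaP LZ.
have [_ JD _] := is_ideal_join idP idY.
have [r [z [b [Phi [_ ZY PhiL PhiM PhiS]]]]] :=
  tens_coordinates (is_idealT A) idY (tensor_gen tens_ij Z).
rewrite -(subrK (\sum_(k < r) i (z k) * j (b k)) Z); apply: JD.
  exact: join_sub_tens_r.
apply: join_sub_tens_l; apply: tens_sum => k; apply: tens_pure => //; apply: LaP.
rewrite /colon /= mulrC -(PhiS _ _ (ltn_ord k)) -PhiM.
apply: PhiL => //.
rewrite -[X in i a * X](subKr Z) mulrBr; apply: is_idealB => //.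
  exact: is_ideal_join.
have [_ _ LM] := is_ideal_join idL idY.
by apply: LM; apply: join_sub_tens_r.
Qed.

Lemma join_colon_inj I P Y f Z : is_ideal I -> is_ideal Y -> P `<=` colon I f ->
  join P Y Z -> join I Y (i f * Z).
Proof.
move=> idI idY PIf PZ; have [_ _ JM] := is_ideal_join idI idY.
suff : join P Y `<=` colon (join I Y) (i f) by move=> /(_ _ PZ); rewrite /colon /= mulrC.
apply: join_min => [|a Pa|b Yb]; first exact/is_ideal_colon/is_ideal_join.
  by rewrite /colon /= -rmorphM; apply: join_inl; apply: PIf.
by rewrite /colon /= mulrC; apply: JM; apply: join_inr.
Qed.

(** Let [F] have coordinates [a k], with [a k0] outside [L], and let [P] be an
   associated prime that contains [colon L (a k0)]. With [N] from
   [socle_extension] and a suitable [c], the element [c * F] is nonzero modulo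
   [join N Y], with coordinates [d k * a k0]. As [colon N (a k0)] and [colon I f]
   are both [P], replacing [a k0] by [f] leaves the element nonzero and keeps its
   annihilator. *)
Lemma colon_join_transfer I L Y F : is_ideal I -> is_ideal L -> is_ideal Y ->
  (forall m, ~ L m -> exists2 P, associated_primes I P & colon L m `<=` P) ->
  ~ join L Y F ->
  exists2 F', ~ join I Y F' & colon (join L Y) F `<=` colon (join I Y) F'.
Proof.
move=> idI idL idY LI nF.
have [r [a [b [Phi [_ FY PhiL PhiM PhiS]]]]] :=
  tens_coordinates (is_idealT A) idY (tensor_gen tens_ij F).
have [k0 k0r nLk0] : exists2 k, (k < r)%N & ~ L (a k).
  apply: contrapT => H; apply: nF.
  have [_ JD _] := is_ideal_join idL idY.
  rewrite -(subrK (\sum_(k < r) i (a k) * j (b k)) F).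
  apply: JD; first exact: join_sub_tens_r.
  apply: join_sub_tens_l; apply: tens_sum => k; apply: tens_pure => //.
  by apply: contrapT => nLk; apply: H; exists k.
have [P PI LP] := LI _ nLk0; have [idP nP1 prP [f Pf]] := associated_primesP PI.
have [N [idN LN NP ess]] := socle_extension idL idP nP1 prP LP.
have [N0 ND NM] := idN.
have [z Nz|| c [[k1 k1r nNk1] cN]] := @socle_multiplier _ N (a k0) r a idN.
- have [e [c [nPe Nec]]] := ess _ Nz; exists e, c; split=> // Ne.
  by apply: nPe; rewrite -NP.
- by exists k0 => // Nk0; apply: nP1; rewrite -NP /colon /= mul1r.
have cN' k : exists d, (k < r)%N -> N (c * a k - d * a k0).
  have [kr|nkr] := pselect (k < r)%N; last by exists 0.
  by have [d Nd] := cN k kr; exists d.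
have [d dN] := choice cN'.
pose D := \sum_(k < r) i (d k) * j (b k).
have idJN := is_ideal_join idN idY; have [J0 JD JM] := idJN.
have idJI := is_ideal_join idI idY.
exists (i f * D).
  have -> : i f * D = \sum_(k < r) i (f * d k) * j (b k).
    by rewrite mulr_sumr; apply: eq_bigr => k _; rewrite mulrA rmorphM.
  move=> /(PhiL k1 _ _ idI); rewrite (PhiS k1 (fun k => f * d k)) //.
  rewrite mulrC => Id; apply: nNk1.
  rewrite -[c * _](subrK (d k1 * a k0)); apply: ND; first exact: dN.
  have : P (d k1) by rewrite Pf.
  by rewrite -NP.
move=> H JH; rewrite /colon /= mulrCA.
apply: (join_colon_inj (P := P)) => //; first by rewrite Pf.
apply: (join_colon_sub (a := a k0) idN idP idY); first by rewrite NP.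
have -> : i (a k0) * (H * D) = i c * (H * F) - H * (i c * F - i (a k0) * D).
  by rewrite mulrBr opprB [in RHS]mulrCA addrC subrK mulrCA.
apply: is_idealB => //; apply: (JM); first by apply: joinS JH.
have -> : i c * F - i (a k0) * D = i c * (F - \sum_(k < r) i (a k) * j (b k))
    + \sum_(k < r) i (c * a k - d k * a k0) * j (b k).
  rewrite mulrBr -addrA; congr (_ + _).
  rewrite !mulr_sumr -!sumrN -big_split /=; apply: eq_bigr => k _.
  rewrite rmorphB /= !rmorphM /= mulrBl !mulrA addKr.
  by rewrite [i (d k) * _]mulrC.
apply: JD; first by apply: JM; apply: join_sub_tens_r.
by apply: join_sub_tens_l; apply: tens_sum => k; apply: tens_pure => //; apply: dN.
Qed.

End Tensor.

(** * Powers and symbolic powers of a sum of ideals in separate variables *)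

Lemma is_tensorC (K : fieldType) (A B S : comAlgType K)
    (i : {lrmorphism A -> S}) (j : {lrmorphism B -> S}) :
  is_tensor i j -> is_tensor j i.
Proof.
case=> gen extr extl; split=> [F|phi|phi]; first by apply/tensC/gen.
  by have [Phi PhiE] := extl phi; exists Phi => a b; rewrite mulrC.
by have [Phi PhiE] := extr phi; exists Phi => a b; rewrite mulrC.
Qed.

Lemma joinC (K : fieldType) (A B S : comAlgType K)
    (i : {lrmorphism A -> S}) (j : {lrmorphism B -> S}) X Y :
  join i j X Y `<=` join j i Y X.
Proof.
move=> F [G XG YG]; exists (F - G); first exact: tensC.
by rewrite subKr; apply: tensC.
Qed.

Section SumOfIdeals.
Variables (K : fieldType) (A B S : comAlgType K).
Variables (i : {lrmorphism A -> S}) (j : {lrmorphism B -> S}).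
Hypothesis tens_ij : is_tensor i j.
Variables (I : set A) (J : set B).
Hypotheses (idI : is_ideal I) (idJ : is_ideal J).

(** The annihilator in [B] of an element of [S] modulo [I + J] is the intersection
   of the annihilators modulo [J] of its finitely many coordinates; if it is
   prime, it is one of them. *)
Lemma contract_associated_prime Q :
  associated_primes (join i j I J) Q -> associated_primes J (j @^-1` Q).
Proof.
move=> QIJ; have [[Q0 QD QM] nQ1 prQ [F QF]] := associated_primesP QIJ.
have tens_ji := is_tensorC tens_ij.
have [r [b [a [Phi [_ FI PhiL PhiM PhiS]]]]] :=
  tens_coordinates tens_ji (is_idealT B) idI (tensor_gen tens_ji F).
have QP c : Q (j c) <-> forall k, (k < r)%N -> J (c * b k).
  split=> [|cJ].
    rewrite QF /colon /= => /joinC JI k kr.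
    rewrite -(PhiS k b kr) -PhiM; apply: PhiL => //.
    rewrite -[X in j c * X](subKr F) mulrBr.
    have idJI := is_ideal_join tens_ji idJ idI; have [_ _ JIM] := idJI.
    by apply: is_idealB => //; apply: JIM; apply: join_sub_tens_r.
  rewrite QF /colon /=; apply: joinC.
  have [_ JID JIM] := is_ideal_join tens_ji idJ idI.
  rewrite -(subrK (\sum_(k < r) j (b k) * i (a k)) F) mulrDr; apply: JID.
    by apply: JIM; apply: join_sub_tens_r.
  apply: join_sub_tens_l; rewrite mulr_sumr; apply: tens_sum => k.
  by rewrite mulrA -rmorphM; apply: tens_pure => //; apply: cJ.
split.
- apply/idealr_closedP; split; last by rewrite /= rmorph1.
  split=> [|x y Qx Qy|c x Qx]; rewrite /= ?rmorph0 ?rmorphD ?rmorphM //.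
    exact: QD.
  exact: QM.
- by apply/prime_idealr_closedP => u v; rewrite /= rmorphM; apply: prQ.
suff [k kr Qk] : exists2 k, (k < r)%N & colon J (b k) `<=` j @^-1` Q.
  by exists (b k); apply/seteqP; split=> // c /QP; apply.
apply: contrapT => H.
have /choice[c cP] k : exists c, (k < r)%N -> J (c * b k) /\ ~ Q (j c).
  have [kr|] := boolP (k < r)%N; last by exists 0.
  apply: contrapT => Hk; apply: H; exists k => // c Jc.
  by apply: contrapT => nQc; apply: Hk; exists c.
have nQprod : ~ Q (j (\prod_(k < r) c k)).
  apply: (big_ind (fun x => ~ Q (j x))).
  - by rewrite rmorph1.
  - by move=> x y nQx nQy; rewrite rmorphM => /prQ[].
  by move=> k _; case: (cP k (ltn_ord k)).
apply: nQprod; apply/QP => k kr; rewrite (bigD1 (Ordinal kr)) //= mulrAC.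
have [_ _ JM] := idJ; rewrite mulrC; apply: JM.
by case: (cP k kr).
Qed.

(** A product of [s] factors from [I] and [J] has at least [a] factors from [I] or
   at least [b] factors from [J]. *)
Lemma join_pow_sub s a b : (a + b = s.+1)%N ->
  ideal_pow (join i j I J) s `<=` join i j (ideal_pow I a) (ideal_pow J b).
Proof.
elim: s a b => [|s IHs] a b abs.
  move=> F _; case: a abs => [|a] abs.
    by apply: join_sub_tens_l; apply: (tensor_gen tens_ij).
  have -> : b = 0%N by case: a b abs => [|a] [].
  by apply: join_sub_tens_r; apply: (tensor_gen tens_ij).
have idab a' b' := is_ideal_join tens_ij (is_ideal_pow I a') (is_ideal_pow J b').
suff H : join i j I J `<=` [set F | forall G, ideal_pow (join i j I J) s G ->
    join i j (ideal_pow I a) (ideal_pow J b) (F * G)].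
  by apply: ideal_powS_min => // F G /H; apply.
apply: join_min.
- have [I0 ID IM] := idab a b; split=> [G _|x y Ix Iy G JG|c x Ix G JG].
  + by rewrite mul0r.
  + by rewrite mulrDl; apply: ID; [apply: Ix | apply: Iy].
  by rewrite -mulrA; apply: IM; apply: Ix.
- move=> x Ix G JG; case: a abs => [|a] [abs].
    by apply: join_sub_tens_l; apply: (tensor_gen tens_ij).
  apply: (join_colon_inj tens_ij _ _ _ (IHs a b abs G JG)).
  + exact: is_ideal_pow.
  + exact: is_ideal_pow.
  by move=> y Iy; rewrite /colon /= mulrC; apply: ideal_powS.
move=> y Jy G JG; case: b abs => [|b] abs.
  by apply: join_sub_tens_r; apply: (tensor_gen tens_ij).
apply: joinC; apply: (join_colon_inj (is_tensorC tens_ij) (P := ideal_pow J b)).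
- exact: is_ideal_pow.
- exact: is_ideal_pow.
- by move=> z Jz; rewrite /colon /= mulrC; apply: ideal_powS.
by apply/joinC/IHs => //; rewrite addnS in abs; case: abs.
Qed.

Lemma tens_pow_sub a b :
  tens i j (ideal_pow I a) (ideal_pow J b) `<=` ideal_pow (join i j I J) (a + b).
Proof.
have subi k : ideal_pow I k `<=` i @^-1` ideal_pow (join i j I J) k.
  elim: k => [//|k IHk]; apply: ideal_powS_min.
    have [H0 HD HM] := is_ideal_pow (join i j I J) k.+1.
    split=> [|x y Ix Iy|c x Ix]; rewrite /= ?rmorph0 ?rmorphD ?rmorphM //.
      exact: HD.
    exact: HM.
  move=> x y Ix Iy /=; rewrite rmorphM; apply: ideal_powS; last exact: IHk.
  exact: join_inl.
have subj k : ideal_pow J k `<=` j @^-1` ideal_pow (join i j I J) k.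
  elim: k => [//|k IHk]; apply: ideal_powS_min.
    have [H0 HD HM] := is_ideal_pow (join i j I J) k.+1.
    split=> [|x y Ix Iy|c x Ix]; rewrite /= ?rmorph0 ?rmorphD ?rmorphM //.
      exact: HD.
    exact: HM.
  move=> x y Ix Iy /=; rewrite rmorphM; apply: ideal_powS; last exact: IHk.
  exact: join_inr.
apply: tens_sub; first exact: is_ideal_pow.
by move=> x y /subi Ix /subj Jy; apply: ideal_powD.
Qed.

(** The extensions to [S] of the powers of [I] and of those of [J] are two chains
   of subgroups, so they generate a distributive lattice, in which this
   intersection of sums is the sum of the intersections of the powers whose
   exponents add up to [t]; [tens_inter] turns intersections into products. *)
Lemma bigcap_join_sub_pow t F :
  (forall a, (a < t)%N ->
     join i j (ideal_pow I a.+1) (ideal_pow J (t - a)) F) ->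
  ideal_pow (join i j I J) t F.
Proof.
move=> HF; have [W0 WD WM] := is_ideal_pow (join i j I J) t.
have idX k : is_ideal (tens i j (ideal_pow I k) setT).
  by apply: is_ideal_tens => //; apply: is_ideal_pow.
have idY k : is_ideal (tens i j setT (ideal_pow J k)).
  by apply: is_ideal_tens => //; apply: is_ideal_pow.
(* [G] collects the terms split off by the first [k] sums, by the modular law. *)
suff H k : (k <= t)%N -> exists G, [/\ ideal_pow (join i j I J) t G,
    tens i j setT (ideal_pow J (t.+1 - k)) G
    & tens i j (ideal_pow I k) setT (F - G)].
  have [G [WG _ XG]] := H t (leqnn t).
  rewrite -(subrK G F); apply: WD => //.
  by have := @tens_pow_sub t 0; rewrite addn0; apply.
elim: k => [|k IHk] kt.
  by exists 0; split=> //; [exact: tens0 | exact: (tensor_gen tens_ij)].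
have [G [WG YG XG]] := IHk (ltnW kt).
have [G' XG' YG'] := HF k kt.
have YFG : tens i j setT (ideal_pow J (t - k)) (F - G' - G).
  apply: is_idealB => //; apply: tensS YG => //.
  by apply: ideal_pow_sub; rewrite subSn // ltnW.
have XFG : tens i j (ideal_pow I k) setT (F - G' - G).
  rewrite addrAC; apply: is_idealB => //; apply: tensS XG' => //.
  exact: ideal_powSn_sub.
exists (G + (F - G' - G)); split.
- apply: WD => //; rewrite -[t in ideal_pow _ t](subnKC (ltnW kt)).
  by apply: tens_pow_sub; apply: tens_inter => //; apply: is_ideal_pow.
- by rewrite subSS [G + _]addrC subrK.
by rewrite [G + _]addrC subrK subKr.
Qed.

(** If [F] were outside, transferring first [I], then [J], would put the
   annihilator of [F] modulo the right-hand side into a prime [Q] associated with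
   [I + J]; but some element outside [Q] multiplies [F] into the [s]-th power of
   [I + J]. *)
Lemma saturated_join_sub s a b F :
  (forall G, ~ join i j I J G -> exists2 Q, associated_primes (join i j I J) Q
      & colon (join i j I J) G `<=` Q) ->
  (a + b = s.+1)%N -> saturated_power (join i j I J) s F ->
  join i j (saturated_power I a) (saturated_power J b) F.
Proof.
move=> primeIJ abs satF; apply: contrapT => nF.
have idIa := is_ideal_saturated I a; have idJb := is_ideal_saturated J b.
have [F1 nF1 F1P] := colon_join_transfer tens_ij idI idIa idJb
  (@saturated_colon_sub _ I a) nF.
have [|F2 nF2 F2P] := colon_join_transfer (is_tensorC tens_ij) idJ idJb idI
  (@saturated_colon_sub _ J b) (F := F1).
  by move=> /joinC.
have [Q QIJ QP] := primeIJ F2 (fun H => nF2 (joinC H)).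
have [h nQh hF] := satF Q QIJ.
apply: nQh; apply: QP; apply: joinC; apply: F2P; apply: joinC; apply: F1P.
have := join_pow_sub abs hF.
by apply: joinS; apply: ideal_pow_sub_saturated.
Qed.

Lemma saturated_power_incl s g :
  saturated_power J s g -> saturated_power (join i j I J) s (j g).
Proof.
move=> satg Q QIJ; have [h nQh hg] := satg _ (contract_associated_prime QIJ).
exists (j h) => //.
have -> : j h * j g = i 1 * j (h * g) by rewrite rmorph1 mul1r rmorphM.
by apply: (@tens_pow_sub 0 s); apply: tens_pure.
Qed.

(** The power is contained in the sum of the extensions of [I] and of
   [ideal_pow J t]. A functional on [A] that kills [I] but not [1] induces a
   [B]-linear retraction of [S] onto [B], which kills the first extension and
   maps the second one into [ideal_pow J t]. *)
Lemma pow_join_contract t g : ~ I 1 ->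
  ideal_pow (join i j I J) t (j g) -> ideal_pow J t g.
Proof.
move=> nI1 /(@join_pow_sub t 1 t erefl)[G IG JG].
have [||phi [phiI phi1]] := @separating_functional K A (ideal_pow I 1) 1.
- have [I0 ID IM] := is_ideal_pow I 1; split=> // c u v Iu Iv; apply: ID => //.
  by apply: is_idealZ => //; exact: is_ideal_pow.
- by move=> /(ideal_powS_min idI)H; apply/nI1/H => x y Ix _; case: idI => _ _;
    rewrite mulrC; apply.
have [Phi PhiE] := tensor_ext_l tens_ij phi.
have <- : Phi (j g) = g.
  by have := PhiE 1 g; rewrite rmorph1 mul1r phi1 scale1r.
have -> : Phi (j g) = Phi (j g - G).
  rewrite raddfB /=; suff -> : Phi G = 0 by rewrite subr0.
  elim: IG => [|x y G' Ix _ _ IH]; first exact: raddf0.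
  by rewrite raddfD /= IH PhiE phiI // scale0r addr0.
have [J0 JD JM] := is_ideal_pow J t.
elim: JG => [|x y G' _ Jy _ IH]; first by rewrite raddf0.
rewrite raddfD /= PhiE; apply: JD => //.
by apply: is_idealZ => //; exact: is_ideal_pow.
Qed.

End SumOfIdeals.

(** * Polynomial rings are Noetherian *)

(** Each term is a minimum of [v] over the indices that follow the previous one. *)
Lemma nondecreasing_subsequence (v : nat -> nat) : exists g : nat -> nat,
  {homo g : p q / (p < q)%N} /\ forall p q, (p <= q)%N -> (v (g p) <= v (g q))%N.
Proof.
have minv N : exists p, (N <= p)%N /\ forall q, (N <= q)%N -> (v p <= v q)%N.
  have : exists x, `[< exists2 p, (N <= p)%N & v p = x >].
    by exists (v N); apply/asboolP; exists N.
  move=> /ex_minnP[x /asboolP[p Np <-] xmin]; exists p; split=> // q Nq.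
  by apply: xmin; apply/asboolP; exists q.
have [h hP] := choice minv.
pose g := fix g k := if k is k'.+1 then h (g k').+1 else h 0%N.
have gS k : (g k < g k.+1)%N by have [] := hP (g k).+1.
have g_incr : {homo g : p q / (p < q)%N} by apply: (homo_ltn ltn_trans gS).
exists g; split=> // p q; rewrite leq_eqVlt => /orP[/eqP -> //|pq].
have gpq := g_incr _ _ pq.
case: p pq gpq => [|p] pq gpq /=; first by have [_] := hP 0%N; apply.
have [_] := hP (g p).+1; apply.
by apply: ltn_trans gpq; apply: gS.
Qed.

(** Dickson's lemma: the sequence is thinned out once for each variable. *)
Lemma dickson n (u : nat -> 'X_{1..n}) :
  exists p q, (p < q)%N /\ (u p <= u q)%MM.
Proof.
have H k : (k <= n)%N -> exists g : nat -> nat, {homo g : p q / (p < q)%N} /\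
    forall l : 'I_n, (l < k)%N ->
    forall p q, (p <= q)%N -> (u (g p) l <= u (g q) l)%N.
  elim: k => [|k IHk] kn; first by exists id; split.
  have [g [g_incr gu]] := IHk (ltnW kn).
  have [h [h_incr hv]] := nondecreasing_subsequence (fun p => u (g p) (Ordinal kn)).
  exists (g \o h); split=> [p q /h_incr /g_incr //|l].
  rewrite ltnS leq_eqVlt => /orP[/eqP lk|lk] p q pq /=.
    by rewrite (_ : l = Ordinal kn) ?hv //; apply: val_inj.
  apply: gu => //; move: pq; rewrite leq_eqVlt => /orP[/eqP ->//|/h_incr].
  exact: ltnW.
have [g [g_incr gu]] := H n (leqnn n).
exists (g 0%N), (g 1%N); split; first exact: g_incr.
by apply/mnm_lepP => l; apply: gu.
Qed.

Definition noetherian (S : comNzRingType) : Prop :=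
  forall X : nat -> set S, (forall k, is_ideal (X k)) ->
  (forall k, X k `<=` X k.+1) -> exists k, X k.+1 `<=` X k.

(** In a strictly increasing chain, choose at each step a new element with the
   least possible leading monomial. None of these monomials divides a later one,
   since otherwise the later element could be reduced. This contradicts Dickson's
   lemma. *)
Lemma noetherian_mpoly (K : fieldType) n : noetherian {mpoly K[n]}.
Proof.
move=> X idX XS; apply: contrapT => nX.
have monoX p q : (p <= q)%N -> X p `<=` X q.
  move=> /subnK <-; elim: (q - p)%N => // k IHk.
  by rewrite addSn; apply: subset_trans IHk _.
have newP k : exists f, [/\ X k.+1 f, ~ X k f
    & forall g, X k.+1 g -> ~ X k g -> (mlead f <= mlead g)%O].
  have /existsNP[f /not_implyP[Xf nXf]] : ~ X k.+1 `<=` X k.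
    by move=> H; apply: nX; exists k.
  elim/(@mleadrect n K): f Xf nXf => f IHf Xf nXf.
  have [[g [Xg nXg gf]]|nlt] :=
    pselect (exists g, [/\ X k.+1 g, ~ X k g & (mlead g < mlead f)%O]).
    exact: IHf gf Xg nXg.
  exists f; split=> // g Xg nXg; rewrite leNgt; apply/negP => gf.
  by apply: nlt; exists g.
have [f fP] := choice newP.
have [p [q [pq fpq]]] := dickson (fun k => mlead (f k)).
have [Xp nXp _] := fP p; have [Xq nXq minq] := fP q.
have [_ XD XM] := idX q.
have Xqp : X q (f p) by apply: monoX Xp.
have nz k : f k != 0.
  have [_ nXk _] := fP k; apply/eqP => f0; apply: nXk; rewrite f0.
  by case: (idX k).
pose m := (mlead (f q) - mlead (f p))%MM.
pose c := mleadc (f q) / mleadc (f p).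
pose g := c *: ('X_[m] * f p).
have Xg : X q g by rewrite /g -mul_mpolyC; apply: (XM); apply: XM.
have nzc : c != 0 by rewrite mulf_neq0 ?invr_eq0 ?mleadc_eq0.
have mX : mleadc ('X_[m] : {mpoly K[n]}) = 1 by rewrite mleadXm mcoeffX eqxx.
have leadXp : mlead ('X_[m] * f p) = mlead (f q).
  rewrite mleadM_proper ?mleadXm ?submK //.
  by rewrite -[X in _@_X](mleadXm K) mX mul1r mleadc_eq0.
have leadcXp : mleadc ('X_[m] * f p) = mleadc (f p).
  rewrite mleadcM_proper mX mul1r // mleadc_eq0; exact: nz.
have leadg : mlead g = mlead (f q).
  by rewrite mleadZ_proper leadXp // -leadXp leadcXp mulf_neq0 // mleadc_eq0.
have leadcg : mleadc g = mleadc (f q).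
  by rewrite leadg -{1}leadXp /g mcoeffZ leadcXp divfK // mleadc_eq0.
have nXd : ~ X q (f q - g) by move=> Xd; apply: nXq; rewrite -(subrK g (f q)); apply: XD.
have /(minq _)/(_ nXd) : X q.+1 (f q - g).
  by apply: is_idealB => //; apply: XS.
rewrite leNgt => /negP; apply.
have le_d : (mlead (f q - g) <= mlead (f q))%O.
  by apply: le_trans (mleadB_le _ _) _; rewrite leadg leUx lexx.
rewrite lt_neqAle le_d andbT; apply/eqP => eq_d.
have : (f q - g)@_(mlead (f q - g)) == 0.
  by rewrite eq_d mcoeffB -{2}leadg leadcg subrr.
rewrite mleadc_eq0 => /eqP d0; apply: nXd; rewrite d0.
by case: (idX q).
Qed.

(** The chain condition yields a multiple of [F] whose annihilator is maximal
   among those of the multiples of [F] outside [I]. *)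
Lemma colon_sub_associated_prime (S : comNzRingType) (I : set S) F :
  noetherian S -> is_ideal I -> ~ I F ->
  exists2 Q, associated_primes I Q & colon I F `<=` Q.
Proof.
move=> noeth idI nF; apply: contrapT => nQ; have [_ _ IM] := idI.
have nextP v : exists w, ~ I (v * F) ->
    ~ I (w * v * F) /\ ~ (colon I (w * v * F) `<=` colon I (v * F)).
  have [Iv|nv] := pselect (I (v * F)); first by exists 0 => /(_ Iv).
  apply: contrapT => Hw; apply: nQ; exists (colon I (v * F)).
    apply: maximal_colon_prime => // w nw; apply: contrapT => Hc; apply: Hw.
    by exists w; rewrite -mulrA.
  by move=> c Ic; rewrite /colon /= mulrCA; apply: IM.
have [w wP] := choice nextP.
pose v := fix v k := if k is k'.+1 then w (v k') * v k' else 1.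
have nv k : ~ I (v k * F).
  by elim: k => [|k /wP[]//]; rewrite mul1r.
have [k|k|k] := noeth (fun k => colon I (v k * F)).
- exact: is_ideal_colon.
- by move=> c Ic; rewrite /colon /= -mulrA mulrCA; apply: IM.
by have [_] := wP _ (nv k); apply.
Qed.

(** * The polynomial ring in two groups of variables as a tensor product *)

Section LinearExtension.
Variables (K : fieldType) (n : nat) (V : lmodType K) (g : 'X_{1..n} -> V).

Definition lin_ext (p : {mpoly K[n]}) : V := \sum_(m <- msupp p) p@_m *: g m.

Lemma lin_extE k p : (msize p <= k)%N ->
  lin_ext p = \sum_(m : 'X_{1..n < k}) p@_m *: g m.
Proof.
move=> pk; rewrite /lin_ext (big_mksub 'X_{1..n < k}) //=; first last.
- by move=> x /msize_mdeg_lt /leq_trans; apply.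
- by rewrite msupp_uniq.
by rewrite big_rmcond //= => m /memN_msupp_eq0 ->; rewrite scale0r.
Qed.

Lemma lin_ext_is_linear : linear lin_ext.
Proof.
move=> c p q; pose k := maxn (msize (c *: p + q)) (maxn (msize p) (msize q)).
rewrite !(@lin_extE k) ?leq_max ?leqnn ?orbT // scaler_sumr -big_split /=.
by apply: eq_bigr => m _; rewrite mcoeffD mcoeffZ scalerDl scalerA.
Qed.

HB.instance Definition _ :=
  GRing.isLinear.Build K {mpoly K[n]} V *:%R lin_ext lin_ext_is_linear.

Lemma lin_extX m : lin_ext 'X_[m] = g m.
Proof. by rewrite /lin_ext msuppX big_seq1 mcoeffX eqxx scale1r. Qed.

End LinearExtension.

Section TwoGroups.
Variables (K : fieldType) (m n : nat).

HB.instance Definition _ := GRing.LRMorphism.copy (@x_embed K m n)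
  (comp_mpoly [tuple 'X_(lshift n i) | i < m]).
HB.instance Definition _ := GRing.LRMorphism.copy (@y_embed K m n)
  (comp_mpoly [tuple 'X_(rshift m j) | j < n]).

Definition mnm_left (u : 'X_{1..m + n}) : 'X_{1..m} := [multinom u (lshift n i) | i < m].
Definition mnm_right (u : 'X_{1..m + n}) : 'X_{1..n} := [multinom u (rshift m i) | i < n].
Definition mnm_glue (a : 'X_{1..m}) (b : 'X_{1..n}) : 'X_{1..m + n} :=
  [multinom match split k with inl l => a l | inr l => b l end | k < m + n].

Lemma mnm_glueK a b : mnm_left (mnm_glue a b) = a /\ mnm_right (mnm_glue a b) = b.
Proof.
split; apply/mnmP => l; rewrite !mnmE.
  by rewrite -[lshift _ _]/(unsplit (inl l)) unsplitK.
by rewrite -[rshift _ _]/(unsplit (inr l)) unsplitK.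
Qed.

Lemma embed_monomial u :
  x_embed n 'X_[mnm_left u] * y_embed m 'X_[mnm_right u] = 'X_[u] :> {mpoly K[m + n]}.
Proof.
rewrite /x_embed /y_embed !comp_mpolyX mpolyXE_id big_split_ord /=.
by congr (_ * _); apply: eq_bigr => l _; rewrite tnth_mktuple mnmE.
Qed.

Lemma embed_glue a b :
  x_embed n 'X_[a] * y_embed m 'X_[b] = 'X_[mnm_glue a b] :> {mpoly K[m + n]}.
Proof. by rewrite -embed_monomial; have [-> ->] := mnm_glueK a b. Qed.

Lemma embed_sum (p : {mpoly K[m]}) (q : {mpoly K[n]}) :
  x_embed n p * y_embed m q = \sum_(a <- msupp p) \sum_(b <- msupp q)
    (p@_a * q@_b) *: ('X_[mnm_glue a b] : {mpoly K[m + n]}).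
Proof.
rewrite {1}[p]mpolyE {1}[q]mpolyE !linear_sum /= big_distrlr /=.
apply: eq_bigr => a _; apply: eq_bigr => b _.
by rewrite !linearZ /= -scalerAl -scalerAr scalerA embed_glue.
Qed.

Lemma is_tensor_mpoly : is_tensor (@x_embed K m n) (@y_embed K m n).
Proof.
split=> [F|phi|phi].
- rewrite [F]mpolyE; elim: (msupp F) => [|u s IHs]; first by rewrite big_nil; apply: tens0.
  by rewrite big_cons -embed_monomial scalerAl -linearZ; apply: tens_cons.
- exists (lin_ext (fun u => phi 'X_[mnm_right u] *: ('X_[mnm_left u] : {mpoly K[m]}))).
  move=> p q; rewrite embed_sum !raddf_sum /= [in RHS](mpolyE p) [in RHS](mpolyE q).
  rewrite scaler_sumr; apply: eq_bigr => a _.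
  rewrite !linear_sum /= scaler_suml; apply: eq_bigr => b _.
  rewrite linearZ /= lin_extX; have [-> ->] := mnm_glueK a b.
  rewrite !scalerA; congr (_ *: _).
  by rewrite [phi (_ *: _)]linearZ /= -[RHS]mulrA [RHS]mulrCA mulrC [X in _ * X]mulrC.
exists (lin_ext (fun u => phi 'X_[mnm_left u] *: ('X_[mnm_right u] : {mpoly K[n]}))).
move=> p q; rewrite embed_sum !raddf_sum /= [in RHS](mpolyE p) [in RHS](mpolyE q).
rewrite [phi (\sum_(_ <- _) _)]linear_sum /= scaler_suml; apply: eq_bigr => a _.
rewrite !linear_sum /=; apply: eq_bigr => b _.
rewrite linearZ /= lin_extX; have [-> ->] := mnm_glueK a b.
rewrite !scalerA; congr (_ *: _).
by rewrite [phi (_ *: _)]linearZ /= mulrAC.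
Qed.

Lemma ideal_sumE (I : set {mpoly K[m]}) (J : set {mpoly K[n]}) :
  is_ideal I -> is_ideal J ->
  ideal_sum I J = join (@x_embed K m n) (@y_embed K m n) I J.
Proof.
move=> idI idJ; apply/seteqP; split.
  apply: ideal_gen_min; first exact: (is_ideal_join is_tensor_mpoly).
  by move=> _ [[p Ip <-]|[q Jq <-]]; [apply: join_inl | apply: join_inr].
apply: join_min => [|p Ip|q Jq]; first exact: is_ideal_gen.
  by apply: ideal_gen_sub; left; exists p.
by apply: ideal_gen_sub; right; exists q.
Qed.

End TwoGroups.

(** * Resurgence *)

Section Degree.
Variables (K : fieldType) (n : nat).

Definition order_at_least (d : nat) : set {mpoly K[n]} :=
  [set f | forall u, u \in msupp f -> (d <= mdeg u)%N].

Lemma is_ideal_order_at_least d : is_ideal (order_at_least d).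
Proof.
split=> [u|f g fd gd u|c f fd u]; first by rewrite msupp0.
  by move=> /msuppD_le; rewrite mem_cat => /orP[/fd|/gd].
move=> /msuppM_le /allpairsP[[v w] /= [_ /fd dw ->]].
by rewrite mdegD; apply: leq_trans dw (leq_addl _ _).
Qed.

Lemma order_at_leastM d e f g : order_at_least d f -> order_at_least e g ->
  order_at_least (d + e) (f * g).
Proof.
move=> fd ge u /msuppM_le /allpairsP[[v w] /= [/fd dv /ge ew ->]].
by rewrite mdegD leq_add.
Qed.

(** Let [d] be the least degree of a nonzero homogeneous generator [g] of [J]; it
   is positive since [J] is proper. Then [g ^+ s] has degree [d * s], too small for
   the next power of [J]. *)
Lemma homogeneous_pow_not_sub (J : set {mpoly K[n]}) s :
  is_ideal J -> ~ J 1 -> J <> [set 0] -> homogeneous_ideal J ->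
  ~ (ideal_pow J s `<=` ideal_pow J s.+1).
Proof.
move=> idJ nJ1 nJ0 [A homA JA]; have [J0 JD JM] := idJ.
have AJ : A `<=` J by rewrite JA; apply: ideal_gen_sub.
have [d [[g [Ag nzg gd]] dmin]] : exists d,
    (exists g, [/\ A g, g != 0 & g \is d.-homog]) /\
    forall e f, A f -> f != 0 -> f \is e.-homog -> (d <= e)%N.
  have : exists d, `[< exists g, [/\ A g, g != 0 & g \is d.-homog] >].
    apply: contrapT => H; apply: nJ0; apply/seteqP; split; last by move=> _ ->.
    rewrite JA; apply: ideal_gen_min; first exact: is_ideal0.
    move=> f Af /=; apply/eqP/negPn/negP => nzf; apply: H.
    by have [d fd] := homA f Af; exists d; apply/asboolP; exists f.
  move=> /ex_minnP[d /asboolP Hd dmin]; exists d; split=> // e f Af nzf fe.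
  by apply: dmin; apply/asboolP; exists f.
have Jd : J `<=` order_at_least d.
  rewrite JA; apply: ideal_gen_min; first exact: is_ideal_order_at_least.
  move=> f Af u uf; have [e fe] := homA f Af.
  have nzf : f != 0 by apply: contraTneq uf => ->; rewrite msupp0.
  by rewrite (dhomogP _ _ _ fe) // (dmin e f).
have d_gt0 : (0 < d)%N.
  rewrite lt0n; apply/eqP => d0; apply: nJ1.
  have /msize1_polyC gC : (msize g <= 1)%N.
    by rewrite -mlead_deg // (dhomogP _ _ _ gd) ?mlead_supp // d0.
  have nzc : g@_0 != 0 by apply: contraNneq nzg => c0; rewrite gC c0.
  have -> : 1 = (g@_0)^-1%:MP * g by rewrite {2}gC -mpolyCM mulVf.
  by apply: JM; apply: AJ.
have Jpow k : ideal_pow J k `<=` order_at_least (d * k).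
  elim: k => [|k IHk]; first by move=> f _ u _; rewrite muln0.
  apply: ideal_powS_min => [|a b Ja Jb]; first exact: is_ideal_order_at_least.
  by rewrite mulnS; apply: order_at_leastM; [apply: Jd | apply: IHk].
move=> /(_ _ (ideal_pow_exp s (AJ _ Ag)))/Jpow H.
have nzgs : g ^+ s != 0 by rewrite expf_neq0.
have := H _ (mlead_supp nzgs).
rewrite (dhomogP _ _ _ (dhomogMn s gd)) ?mlead_supp //.
by rewrite mulnS -{2}[(d * s)%N]add0n leq_add2r leqNgt d_gt0.
Qed.

End Degree.

Lemma le_resurgence (R : realType) (D : idomainType) (I : set D) s t :
  (0 < s)%N -> (0 < t)%N -> ~ (symbolic_power I s `<=` ideal_pow I t) ->
  ((s%:R / t%:R)%:E <= resurgence R I)%E.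
Proof. by move=> s0 t0 nst; apply: ereal_sup_ubound; exists s, t. Qed.

Section SumInMpoly.
Variables (K : fieldType) (m n : nat).
Variables (I : set {mpoly K[m]}) (J : set {mpoly K[n]}).
Hypotheses (idI : is_ideal I) (idJ : is_ideal J).

Lemma symbolic_sum_not_sub s t :
  (forall a, (0 < a)%N -> ideal_pow I a = symbolic_power I a) -> (t <= s)%N ->
  ~ (symbolic_power (ideal_sum I J) s `<=` ideal_pow (ideal_sum I J) t) ->
  exists a, (a < t)%N /\ ~ (symbolic_power J (s - a) `<=` ideal_pow J (t - a)).
Proof.
move=> Isymb ts; apply: contra_notP => H.
have tensS := is_tensor_mpoly K m n.
rewrite symbolic_powerE ideal_sumE // => F satF.
apply: (bigcap_join_sub_pow tensS) => // a at_.
have aS : (a.+1 + (s - a) = s.+1)%N by rewrite addSn subnKC // ltnW // (leq_trans at_).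
have : join (@x_embed K m n) (@y_embed K m n)
    (saturated_power I a.+1) (saturated_power J (s - a)) F.
  apply: (saturated_join_sub tensS) aS satF => // G nG.
  apply: colon_sub_associated_prime => //; first exact: noetherian_mpoly.
  exact: (is_ideal_join tensS).
apply: joinS; rewrite -symbolic_powerE; first by rewrite Isymb.
by apply: contrapT => nJ; apply: H; exists a.
Qed.

Lemma symbolic_sub_of_sum s t : ~ I 1 ->
  symbolic_power (ideal_sum I J) s `<=` ideal_pow (ideal_sum I J) t ->
  symbolic_power J s `<=` ideal_pow J t.
Proof.
have tensS := is_tensor_mpoly K m n.
rewrite !symbolic_powerE ideal_sumE // => nI1 H g satg.
by apply: (pow_join_contract tensS idI nI1); apply: H; apply: saturated_power_incl.
Qed.

End SumInMpoly.

Theorem theorem3p6 (R : realType) (K : fieldType) (m n : nat)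
    (I : set {mpoly K[m]}) (J : set {mpoly K[n]}) :
  idealr_closed (mem I) -> I <> [set 0] -> homogeneous_ideal I ->
  idealr_closed (mem J) -> J <> [set 0] -> homogeneous_ideal J ->
  (forall s : nat, (1 <= s)%N -> ideal_pow I s = symbolic_power I s) ->
  resurgence R (ideal_sum I J) = resurgence R J.
Proof.
move=> /idealr_closedP[idI nI1] _ _ /idealr_closedP[idJ nJ1] nJ0 homJ Isymb.
apply/eqP; rewrite eq_le; apply/andP; split; apply: ge_ereal_sup.
  move=> _ [s [t [s0 t0 nst ->]]].
  have [ts|st] := leqP t s.
    have [a [at_ nJa]] := symbolic_sum_not_sub idI idJ Isymb ts nst.
    have as_ : (a < s)%N by apply: leq_trans ts.
    apply: le_trans (le_resurgence R _ _ nJa); rewrite ?subn_gt0 // lee_fin.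
    rewrite ler_pdivrMr ?ltr0n // mulrAC ler_pdivlMr ?ltr0n ?subn_gt0 //.
    rewrite -!natrM ler_nat mulnBr mulnBl leq_sub2l // [(s * a)%N]mulnC.
    by rewrite leq_mul2l ts orbT.
  have nJs : ~ (symbolic_power J s `<=` ideal_pow J s.+1).
    move=> H; apply: (@homogeneous_pow_not_sub _ _ J s) => //.
    by apply: subset_trans H; rewrite symbolic_powerE; apply: ideal_pow_sub_saturated.
  apply: le_trans (le_resurgence R _ _ nJs) => //; rewrite lee_fin.
  by rewrite ler_wpM2l ?ler0n // lef_pV2 ?posrE ?ltr0n // ler_nat.
move=> _ [s [t [s0 t0 nst ->]]]; apply: le_resurgence => // H; apply: nst.
exact: symbolic_sub_of_sum nI1 H.
Qed.
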